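(* Let $D$ be a ring, $\theta_1,\ldots,\theta_n$ commuting automorphisms of the ring $D$, and $\alpha_1,\ldots,\alpha_n,\beta_1,\ldots,\beta_n$ regular, normal elements of $D$. Put, for $i=1,\ldots,n$, $$\sigma_i=\theta_i\omega_{\beta_i},\qquad \tau_i=\omega_{\alpha_i}\theta_i^{-1},\qquad a_i=\alpha_i\beta_i,$$ and, for $i>j$, $$\lambda_{ij}=\theta_i(\beta_i)\,\theta_i\theta_j(\beta_j\beta_i^{-1})\,\theta_j(\beta_j^{-1}),\qquad \lambda'_{ij}=\theta_i(\beta_i\alpha_j)\cdot\theta_j^{-1}\theta_i(\beta_i^{-1})\,\alpha_j^{-1},$$ $$\mu_{ij}=\alpha_i\,\theta_i^{-1}\theta_j(\beta_j)\,\theta_j(\alpha_i^{-1}\beta_j^{-1}),\qquad \mu'_{ij}=\alpha_i\,\theta_i^{-1}(\alpha_j)\,\theta_j^{-1}(\alpha_i^{-1})\,\alpha_j^{-1}.$$ Then $A=D[x,y;\sigma,\tau,a,\Lambda,\Lambda',M,M']$ with these data, where $\sigma=(\sigma_i)$, $\tau=(\tau_i)$, $a=(a_i)$, $\Lambda=(\lambda_{ij})$, $\Lambda'=(\lambda'_{ij})$, $M=(\mu_{ij})$, $M'=(\mu'_{ij})$, is a generalized Weyl algebra of rank $n$, provided $\lambda_{ij},\lambda'_{ij},\mu_{ij},\mu'_{ij}\in D$ for all $i>j$.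
   Context: An element $\alpha\in D$ is normal if $\alpha D=D\alpha$, regular if it is neither a left nor a right zero divisor. A normal regular element $\alpha$ determines the automorphism $\omega_\alpha$ of $D$ by $\alpha d=\omega_\alpha(d)\alpha$ for all $d\in D$. Inverses of normal regular elements are taken in the localization of $D$ at the multiplicative set of its normal regular elements, to which the automorphisms of $D$ extend. Products of maps are compositions. Generalized Weyl algebra (GWA) of rank 1: for a ring $R$, ring endomorphisms $\sigma,\tau$ of $R$ and $a\in R$ with $\tau\sigma(a)=a$, $ar=\tau\sigma(r)a$ and $\sigma(a)r=\sigma\tau(r)\sigma(a)$ for all $r\in R$, $R[x,y;\sigma,\tau,a]$ is the ring generated by $R$, $x$, $y$ subject to $xr=\sigma(r)x$, $yr=\tau(r)y$ for all $r\in R$, $yx=a$, $xy=\sigma(a)$. GWA of rank $n$: an iterated GWA $A=D[x_1,y_1;\sigma_1,\tau_1,a_1]\cdots[x_n,y_n;\sigma_n,\tau_n,a_n]$ (i.e. $A_0=D$, $A_i=A_{i-1}[x_i,y_i;\sigma_i,\tau_i,a_i]$ is a GWA of rank 1 over $A_{i-1}$ with $\sigma_i,\tau_i$ endomorphisms of $A_{i-1}$, $A=A_n$) such that $a_1,\ldots,a_n\in D$, $\sigma_i(D)\subseteq D$ and $\tau_i(D)\subseteq D$ for all $i$, and for all $i>j$: $\sigma_i(x_j)=\lambda_{ij}x_j$, $\sigma_i(y_j)=\lambda'_{ij}y_j$, $\tau_i(x_j)=\mu_{ij}x_j$, $\tau_i(y_j)=\mu'_{ij}y_j$ for some elements $\lambda_{ij},\lambda'_{ij},\mu_{ij},\mu'_{ij}\in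 D$. It is denoted $D[x,y;\sigma,\tau,a,\Lambda,\Lambda',M,M']$, where the restrictions of $\sigma_i,\tau_i$ to $D$ are denoted by the same letters; thus it is generated by $D$, $x_1,\dots,x_n,y_1,\dots,y_n$ with relations $x_id=\sigma_i(d)x_i$, $y_id=\tau_i(d)y_i$, $y_ix_i=a_i$, $x_iy_i=\sigma_i(a_i)$ for all $i$ and $d\in D$, and $x_ix_j=\lambda_{ij}x_jx_i$, $x_iy_j=\lambda'_{ij}y_jx_i$, $y_ix_j=\mu_{ij}x_jy_i$, $y_iy_j=\mu'_{ij}y_jy_i$ for $i>j$. *)

(* Defs.v *)
From HB Require Import structures.
From mathcomp Require Import all_boot all_order all_algebra.
From mathcomp Require Import boolp.

Set Implicit Arguments.
Unset Strict Implicit.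
Unset Printing Implicit Defensive.

Import GRing.Theory.
Local Open Scope ring_scope.
Local Open Scope quotient_scope.

(* Rings are associative and unital, not necessarily commutative; the zero
   ring is allowed, hence pzRingType throughout. *)

Record raut (D : pzRingType) := Raut {
  raut_fun :> {rmorphism D -> D};
  raut_inv_fun : {rmorphism D -> D};
  rautK : cancel raut_fun raut_inv_fun;
  rautVK : cancel raut_inv_fun raut_fun }.

Definition raut_inv (D : pzRingType) (f : raut D) : raut D :=
  Raut (rautVK f) (rautK f).

(* alpha D = D alpha *)
Definition normal_elt (D : pzRingType) (s : D) : Prop :=
  (forall d, exists e, s * d = e * s) /\ (forall d, exists e, d * s = s * e).

Record nreg (D : pzRingType) := NReg {
  nreg_val :> D;
  nreg_normal : normal_elt nreg_val;
  nreg_lreg : GRing.lreg nreg_val;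
  nreg_rreg : GRing.rreg nreg_val }.

HB.instance Definition _ (D : pzRingType) := gen_eqMixin (nreg D).
HB.instance Definition _ (D : pzRingType) := gen_choiceMixin (nreg D).

Section Omega.
Variable D : pzRingType.
Implicit Types (s t u v : nreg D) (d e : D) (f : raut D).

Fact omega_ex s d : exists e, (s : D) * d == e * (s : D).
Proof. by have [+ _] := nreg_normal s => /(_ d)[e /eqP]; exists e. Qed.

Fact omegaV_ex s d : exists e, d * (s : D) == (s : D) * e.
Proof. by have [_ +] := nreg_normal s => /(_ d)[e /eqP]; exists e. Qed.

Definition omega_fun s d : D := xchoose (omega_ex s d).
Definition omegaV_fun s d : D := xchoose (omegaV_ex s d).

Lemma omega_funP s d : (s : D) * d = omega_fun s d * (s : D).
Proof. exact/eqP/(xchooseP (omega_ex s d)). Qed.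

Lemma omegaV_funP s d : d * (s : D) = (s : D) * omegaV_fun s d.
Proof. exact/eqP/(xchooseP (omegaV_ex s d)). Qed.

Fact omega_zmod s : zmod_morphism (omega_fun s).
Proof.
by move=> d e; apply: (@nreg_rreg D s); rewrite -omega_funP mulrBr mulrBl !omega_funP.
Qed.

Fact omega_monoid s : monoid_morphism (omega_fun s).
Proof.
split=> [|d e]; apply: (@nreg_rreg D s); rewrite -omega_funP ?mulr1 ?mul1r //.
by rewrite mulrA omega_funP -!mulrA omega_funP.
Qed.

Fact omegaV_zmod s : zmod_morphism (omegaV_fun s).
Proof.
by move=> d e; apply: (@nreg_lreg D s); rewrite -omegaV_funP mulrBr mulrBl !omegaV_funP.
Qed.

Fact omegaV_monoid s : monoid_morphism (omegaV_fun s).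
Proof.
split=> [|d e]; apply: (@nreg_lreg D s); rewrite -omegaV_funP ?mulr1 ?mul1r //.
by rewrite mulrA -omegaV_funP -!mulrA omegaV_funP.
Qed.

HB.instance Definition _ s :=
  GRing.isZmodMorphism.Build D D (omega_fun s) (omega_zmod s).
HB.instance Definition _ s :=
  GRing.isMonoidMorphism.Build D D (omega_fun s) (omega_monoid s).
HB.instance Definition _ s :=
  GRing.isZmodMorphism.Build D D (omegaV_fun s) (omegaV_zmod s).
HB.instance Definition _ s :=
  GRing.isMonoidMorphism.Build D D (omegaV_fun s) (omegaV_monoid s).

Fact omegaK s : cancel (omega_fun s) (omegaV_fun s).
Proof. by move=> d; apply: (@nreg_lreg D s); rewrite -omegaV_funP -omega_funP. Qed.

Fact omegaVK s : cancel (omegaV_fun s) (omega_fun s).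
Proof. by move=> d; apply: (@nreg_rreg D s); rewrite -omega_funP -omegaV_funP. Qed.

Definition omega s : raut D := @Raut D (omega_fun s) (omegaV_fun s) (@omegaK s) (@omegaVK s).

Lemma omegaP s d : (s : D) * d = omega s d * (s : D).
Proof. exact: omega_funP. Qed.

Lemma omega_uniq s d e : (s : D) * d = e * (s : D) -> omega s d = e.
Proof. by move=> h; apply: (@nreg_rreg D s); rewrite -omegaP. Qed.

Fact nreg1_normal : normal_elt (1 : D).
Proof. by split=> d; exists d; rewrite mul1r mulr1. Qed.
Fact nreg1_rreg : GRing.rreg (1 : D).
Proof. by move=> d e; rewrite !mulr1. Qed.
Definition nreg1 : nreg D := NReg nreg1_normal (@lreg1 D) nreg1_rreg.

Fact nregM_normal s t : normal_elt ((s : D) * (t : D)).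
Proof.
split=> d.
  exists (omega s (omega t d)).
  by rewrite -mulrA (omega_funP t) mulrA (omega_funP s) mulrA.
exists (omegaV_fun t (omegaV_fun s d)).
by rewrite mulrA (omegaV_funP s) -mulrA (omegaV_funP t) mulrA.
Qed.
Fact nregM_lreg s t : GRing.lreg ((s : D) * (t : D)).
Proof. exact: lregM (@nreg_lreg D s) (@nreg_lreg D t). Qed.
Fact nregM_rreg s t : GRing.rreg ((s : D) * (t : D)).
Proof. exact: rregM (@nreg_rreg D s) (@nreg_rreg D t). Qed.
Definition nregM s t : nreg D := NReg (nregM_normal s t) (@nregM_lreg s t) (@nregM_rreg s t).

Fact raut_normal f s : normal_elt (f (s : D)).
Proof.
split=> d.
  by exists (f (omega s (raut_inv f d))); rewrite -{1}(rautVK f d) -!rmorphM omega_funP.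
exists (f (omegaV_fun s (raut_inv f d))).
by rewrite -{1}(rautVK f d) -!rmorphM omegaV_funP.
Qed.
Fact raut_lreg f s : GRing.lreg (f (s : D)).
Proof.
move=> d e; rewrite -[d](rautVK f) -[e](rautVK f) -!rmorphM.
by move=> /(can_inj (rautK f))/nreg_lreg ->.
Qed.
Fact raut_rreg f s : GRing.rreg (f (s : D)).
Proof.
move=> d e; rewrite -[d](rautVK f) -[e](rautVK f) -!rmorphM.
by move=> /(can_inj (rautK f))/nreg_rreg ->.
Qed.
Definition raut_nreg f s : nreg D := NReg (raut_normal f s) (@raut_lreg f s) (@raut_rreg f s).

End Omega.

(* Localization of D at its normal regular elements. The pair (s, d) stands for
   the left fraction s^-1 d. *)
Section Localization.
Variable D : pzRingType.
Local Notation frac := (nreg D * D)%type.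
Implicit Types (s t u v w : nreg D) (d e : D) (f : raut D) (p q r : frac).

Definition eqfracP p q : Prop :=
  exists u v, (u : D) * (p.1 : D) = (v : D) * (q.1 : D) /\ (u : D) * p.2 = (v : D) * q.2.
Definition eqfrac p q : bool := `[< eqfracP p q >].

Fact eqfrac_refl : reflexive eqfrac.
Proof. by move=> p; apply/asboolP; exists (nreg1 D), (nreg1 D). Qed.

Fact eqfrac_sym : symmetric eqfrac.
Proof.
by move=> p q; apply/asboolP/asboolP => -[u [v [h1 h2]]]; exists v, u.
Qed.

Fact eqfrac_trans : transitive eqfrac.
Proof.
move=> q p r /asboolP[u [v [h1 h2]]] /asboolP[u' [v' [h3 h4]]]; apply/asboolP.
exists (nregM (raut_nreg (omega v) u') u), (nregM v v') => /=.
split.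
  by rewrite -mulrA h1 mulrA -omega_funP -!mulrA h3.
by rewrite -mulrA h2 mulrA -omega_funP -!mulrA h4.
Qed.

Canonical eqfrac_equiv := EquivRel eqfrac eqfrac_refl eqfrac_sym eqfrac_trans.

Definition loc := {eq_quot eqfrac}.
HB.instance Definition _ : EqQuotient _ eqfrac loc := EqQuotient.on loc.
HB.instance Definition _ := Choice.on loc.

Lemma loc_eqP p q : (\pi_loc p = \pi_loc q) <-> eqfracP p q.
Proof.
by split=> [/eqmodP/asboolP|h] //; apply/eqmodP/asboolP.
Qed.

Definition addf p q : frac :=
  (nregM p.1 q.1, omega p.1 (q.1 : D) * p.2 + (p.1 : D) * q.2).
Definition oppf p : frac := (p.1, - p.2).
(* d t^-1 = t^-1 omega_t(d) *)
Definition mulf p q : frac := (nregM q.1 p.1, omega q.1 p.2 * q.2).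

Definition loc_add (x y : loc) : loc := \pi_loc (addf (repr x) (repr y)).
Definition loc_opp (x : loc) : loc := \pi_loc (oppf (repr x)).
Definition loc_mul (x y : loc) : loc := \pi_loc (mulf (repr x) (repr y)).
Definition loc_in d : loc := \pi_loc (nreg1 D, d).

Lemma repr_pi p : eqfracP (repr (\pi_loc p)) p.
Proof. by apply/loc_eqP; rewrite reprK. Qed.

Lemma omegaM s t : omega (nregM s t) =1 omega s \o omega t.
Proof.
move=> d; apply: omega_uniq => /=.
by rewrite -mulrA (omega_funP t) mulrA (omega_funP s) mulrA.
Qed.

Lemma omega_ext s t : s = t :> D -> omega s =1 omega t.
Proof. by move=> h d; apply: omega_uniq; rewrite h omegaP. Qed.

Lemma omega_mulC u s d e :
  (u : D) * (omega_fun s d * e) = omega_fun (nregM u s) d * ((u : D) * e).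
Proof. by rewrite mulrA (omega_funP u) [in RHS](omegaM u s d) mulrA. Qed.

Lemma loc_addE p q : loc_add (\pi_loc p) (\pi_loc q) = \pi_loc (addf p q).
Proof.
rewrite /loc_add; have := repr_pi p; have := repr_pi q.
case: (repr (\pi_loc p)) (repr (\pi_loc q)) => [s' d'] [t' e'].
case: p q => [s d] [t e] [v [v' [/= hv1 hv2]]] [u [u' [/= hu1 hu2]]].
transitivity (\pi_loc (addf (s, d) (t', e'))); apply/loc_eqP.
  exists u, u'; rewrite /= !mulrDr !omega_mulC hu2 !mulrA hu1; split=> //.
  by congr (_ * _ * _ + _); exact: (@omega_ext (nregM u s') (nregM u' s)).
exists (raut_nreg (omega s) v), (raut_nreg (omega s) v') => /=.
rewrite !mulrDr !mulrA -!omega_funP -!rmorphM hv1; split.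
  by rewrite -!mulrA hv1.
by rewrite -[X in _ + X]mulrA hv2 !mulrA.
Qed.

Lemma loc_mulE p q : loc_mul (\pi_loc p) (\pi_loc q) = \pi_loc (mulf p q).
Proof.
rewrite /loc_mul; have := repr_pi p; have := repr_pi q.
case: (repr (\pi_loc p)) (repr (\pi_loc q)) => [s' d'] [t' e'].
case: p q => [s d] [t e] [v [v' [/= hv1 hv2]]] [u [u' [/= hu1 hu2]]].
transitivity (\pi_loc (mulf (s, d) (t', e'))); apply/loc_eqP.
  exists (raut_nreg (omega t') u), (raut_nreg (omega t') u') => /=.
  by rewrite !mulrA -!omega_funP -!rmorphM hu2 -!mulrA hu1.
exists v, v'; rewrite /= !omega_mulC hv2 !mulrA hv1; split=> //.
by congr (_ * _ * _); exact: (@omega_ext (nregM v t') (nregM v' t)).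
Qed.

Lemma loc_oppE p : loc_opp (\pi_loc p) = \pi_loc (oppf p).
Proof.
have [u [u' [hu1 hu2]]] := repr_pi p; apply/loc_eqP.
by exists u, u'; rewrite /= hu1 !mulrN hu2.
Qed.

Lemma loc_expand u s d : \pi_loc (s, d) = \pi_loc (nregM u s, (u : D) * d).
Proof. by apply/loc_eqP; exists u, (nreg1 D); rewrite /= !mul1r. Qed.

Lemma loc_same_add s d e : loc_add (\pi_loc (s, d)) (\pi_loc (s, e)) = \pi_loc (s, d + e).
Proof.
rewrite loc_addE (loc_expand s s (d + e)) /addf /= mulrDr.
by rewrite (omega_uniq (erefl ((s : D) * (s : D)))).
Qed.

Lemma loc_common (x y : loc) : exists s d e, x = \pi_loc (s, d) /\ y = \pi_loc (s, e).
Proof.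
elim/quotW: x => -[s d]; elim/quotW: y => -[t e].
exists (nregM s t), (omega s (t : D) * d), ((s : D) * e); split; last exact: loc_expand.
rewrite (loc_expand (raut_nreg (omega s) t) s d); apply/loc_eqP.
by exists (nreg1 D), (nreg1 D); rewrite /= !mul1r -omega_funP.
Qed.

Lemma loc_common3 (x y z : loc) : exists s d e (f : D),
  [/\ x = \pi_loc (s, d), y = \pi_loc (s, e) & z = \pi_loc (s, f)].
Proof.
have [s [d [e [-> ->]]]] := loc_common x y; elim/quotW: z => -[t f].
exists (nregM s t), (omega s (t : D) * d), (omega s (t : D) * e), ((s : D) * f).
by split; last exact: loc_expand; rewrite (loc_expand (raut_nreg (omega s) t) s);
  apply/loc_eqP; exists (nreg1 D), (nreg1 D); rewrite /= !mul1r -omega_funP.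
Qed.

Lemma loc_zeroE s : loc_in 0 = \pi_loc (s, 0).
Proof.
by apply/loc_eqP; exists s, (nreg1 D); rewrite /= !mulr0 mulr1 mul1r.
Qed.

Fact loc_addA : associative loc_add.
Proof.
move=> x y z; have [s [d [e [f [-> -> ->]]]]] := loc_common3 x y z.
by rewrite !loc_same_add addrA.
Qed.
Fact loc_addC : commutative loc_add.
Proof.
move=> x y; have [s [d [e [-> ->]]]] := loc_common x y.
by rewrite !loc_same_add addrC.
Qed.
Fact loc_add0 : left_id (loc_in 0) loc_add.
Proof.
by elim/quotW=> -[s d]; rewrite (loc_zeroE s) loc_same_add add0r.
Qed.
Fact loc_addN : left_inverse (loc_in 0) loc_opp loc_add.
Proof.
by elim/quotW=> -[s d]; rewrite (loc_zeroE s) loc_oppE loc_same_add addNr.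
Qed.

HB.instance Definition _ :=
  GRing.isZmodule.Build loc loc_addA loc_addC loc_add0 loc_addN.

Fact loc_mulA : associative loc_mul.
Proof.
elim/quotW=> -[s d]; elim/quotW=> -[t e]; elim/quotW=> -[w f].
rewrite (loc_mulE (t, e) (w, f)) (loc_mulE (s, d)) (loc_mulE (s, d) (t, e)).
rewrite loc_mulE /mulf /=; apply/loc_eqP.
exists (nreg1 D), (nreg1 D); rewrite /= !mul1r !mulrA; split=> //.
by rewrite [omega_fun (nregM w t) d](omegaM w t) /= -rmorphM.
Qed.
Fact loc_mul1 : left_id (loc_in 1) loc_mul.
Proof.
elim/quotW=> -[s d]; rewrite loc_mulE /mulf /=; apply/loc_eqP.
by exists (nreg1 D), (nreg1 D); rewrite /= !mul1r mulr1 rmorph1 mul1r.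
Qed.
Fact loc_mulr1 : right_id (loc_in 1) loc_mul.
Proof.
elim/quotW=> -[s d]; rewrite loc_mulE /mulf /=; apply/loc_eqP.
exists (nreg1 D), (nreg1 D); rewrite /= !mul1r mulr1; split=> //.
by rewrite (@omega_uniq D (nreg1 D) d d) //= mul1r mulr1.
Qed.
Fact loc_mulDl : left_distributive loc_mul loc_add.
Proof.
move=> x y; elim/quotW=> -[t f]; have [s [d [e [-> ->]]]] := loc_common x y.
by rewrite loc_same_add !loc_mulE /mulf /= loc_same_add rmorphD mulrDl.
Qed.
Fact loc_mulDr : right_distributive loc_mul loc_add.
Proof.
elim/quotW=> -[t f] x y; have [s [d [e [-> ->]]]] := loc_common x y.
by rewrite loc_same_add !loc_mulE /mulf /= loc_same_add mulrDr.
Qed.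

HB.instance Definition _ := GRing.Zmodule_isPzRing.Build loc
  loc_mulA loc_mul1 loc_mulr1 loc_mulDl loc_mulDr.

Fact loc_in_zmod : zmod_morphism loc_in.
Proof.
move=> d e; rewrite -[RHS]/(loc_add _ (loc_opp _)) /loc_in.
by rewrite loc_oppE loc_same_add.
Qed.
Fact loc_in_monoid : monoid_morphism loc_in.
Proof.
split=> // d e; rewrite -[RHS]/(loc_mul _ _) loc_mulE /mulf /=; apply/loc_eqP.
exists (nreg1 D), (nreg1 D); rewrite /= !mulr1 !mul1r; split=> //.
by rewrite (@omega_uniq D (nreg1 D) d d) //= mul1r mulr1.
Qed.
HB.instance Definition _ :=
  GRing.isZmodMorphism.Build D loc loc_in loc_in_zmod.
HB.instance Definition _ :=
  GRing.isMonoidMorphism.Build D loc loc_in loc_in_monoid.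

Definition loc_inv s : loc := \pi_loc (s, 1).

Lemma loc_in_inj : injective loc_in.
Proof.
move=> d e /loc_eqP[u [v [/= h1 h2]]]; apply: (@nreg_lreg D u).
by move: h1; rewrite !mulr1 => huv; rewrite h2 huv.
Qed.

Lemma loc_fracE s d : \pi_loc (s, d) = loc_inv s * loc_in d.
Proof.
rewrite -[RHS]/(loc_mul _ _) loc_mulE /mulf /=; apply/loc_eqP.
by exists (nreg1 D), (nreg1 D); rewrite /= !mul1r rmorph1 mul1r.
Qed.

Lemma loc_frac (x : loc) : exists s d, x = loc_inv s * loc_in d.
Proof. by elim/quotW: x => -[s d]; exists s, d; exact: loc_fracE. Qed.

Lemma loc_mulVr s : loc_inv s * loc_in s = 1.
Proof.
rewrite -loc_fracE; apply/loc_eqP.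
by exists (nreg1 D), s; rewrite /= mul1r mulr1.
Qed.

Lemma loc_mulrV s : loc_in s * loc_inv s = 1.
Proof.
rewrite -[LHS]/(loc_mul _ _) loc_mulE /mulf /=; apply/loc_eqP.
exists (nreg1 D), s; rewrite /= !mulr1 !mul1r; split=> //.
by rewrite (omega_uniq (erefl ((s : D) * (s : D)))).
Qed.

(* The extension of an automorphism of D to the localization. *)
Definition loc_map f (x : loc) : loc :=
  \pi_loc (raut_nreg f (repr x).1, f (repr x).2).

Lemma loc_mapE f s d : loc_map f (\pi_loc (s, d)) = \pi_loc (raut_nreg f s, f d).
Proof.
have [u [v [h1 h2]]] := repr_pi (s, d); apply/loc_eqP.
by exists (raut_nreg f u), (raut_nreg f v); rewrite /= -!rmorphM h1 h2.
Qed.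

Fact loc_map_zmod f : zmod_morphism (loc_map f).
Proof.
move=> x y; have [s [d [e [-> ->]]]] := loc_common x y.
rewrite -[X in loc_map f X]/(loc_add _ (loc_opp _)).
rewrite -[RHS]/(loc_add _ (loc_opp _)).
by rewrite loc_oppE loc_same_add !loc_mapE loc_oppE loc_same_add rmorphB.
Qed.

Fact loc_map_monoid f : monoid_morphism (loc_map f).
Proof.
split.
  rewrite loc_mapE; apply/loc_eqP.
  by exists (nreg1 D), (nreg1 D); rewrite /= !rmorph1.
elim/quotW=> -[s d]; elim/quotW=> -[t e].
rewrite -[X in loc_map f X]/(loc_mul _ _) -[RHS]/(loc_mul _ _).
rewrite loc_mulE !loc_mapE loc_mulE /mulf /=; apply/loc_eqP.
exists (nreg1 D), (nreg1 D); rewrite /= !rmorphM !mul1r; split=> //.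
congr (_ * _); apply/esym/(@omega_uniq D (raut_nreg f t)) => /=.
by rewrite -!rmorphM omega_funP.
Qed.
HB.instance Definition _ f :=
  GRing.isZmodMorphism.Build loc loc (loc_map f) (loc_map_zmod f).
HB.instance Definition _ f :=
  GRing.isMonoidMorphism.Build loc loc (loc_map f) (loc_map_monoid f).

Lemma loc_map_in f d : loc_map f (loc_in d) = loc_in (f d).
Proof.
rewrite [LHS]loc_mapE; apply/loc_eqP.
by exists (nreg1 D), (nreg1 D); rewrite /= rmorph1.
Qed.

Lemma loc_map_inv f s : loc_map f (loc_inv s) = loc_inv (raut_nreg f s).
Proof. by rewrite [LHS]loc_mapE rmorph1. Qed.

Lemma loc_map_uniq f (F : {rmorphism loc -> loc}) :
  (forall d, F (loc_in d) = loc_in (f d)) -> F =1 loc_map f.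
Proof.
move=> hF x; have [s [d ->]] := loc_frac x; rewrite !rmorphM /= hF loc_map_in.
congr (_ * _); rewrite loc_map_inv -[LHS]mul1r -(loc_mulVr (raut_nreg f s)).
by rewrite -mulrA -[loc_in _]/(loc_in (f (s : D))) -hF -rmorphM loc_mulrV rmorph1 mulr1.
Qed.

End Localization.

(* C, with the map f from R and the elements x, y, satisfies the defining
   relations of R[x, y; s, t, a]. *)
Definition gwa1_rel (R : pzRingType) (s t : R -> R) (a : R)
    (C : pzRingType) (f : {rmorphism R -> C}) (x y : C) : Prop :=
  [/\ forall r, x * f r = f (s r) * x,
      forall r, y * f r = f (t r) * y,
      y * x = f a
    & x * y = f (s a)].

(* "The ring generated by R, x, y subject to the relations" is expressed by
   its universal property. *)
Definition is_gwa1 (R : pzRingType) (s t : {rmorphism R -> R}) (a : R)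
    (A : pzRingType) (i : {rmorphism R -> A}) (x y : A) : Prop :=
  [/\ [/\ t (s a) = a,
          forall r, a * r = t (s r) * a
        & forall r, s a * r = s (t r) * s a],
      gwa1_rel s t a i x y
    & forall (C : pzRingType) (f : {rmorphism R -> C}) (x' y' : C),
        gwa1_rel s t a f x' y' ->
        exists g : {rmorphism A -> C},
          [/\ forall r, g (i r) = f r, g x = x', g y = y'
            & forall h : {rmorphism A -> C},
                (forall r, h (i r) = f r) -> h x = x' -> h y = y' -> h =1 g]].

(* Only the entries (i, j) with j < i of the last four families are used. *)
Record gwa_data (D : pzRingType) (n : nat) := GwaData {
  gw_sigma : 'I_n -> D -> D;
  gw_tau : 'I_n -> D -> D;
  gw_a : 'I_n -> D;
  gw_lam : 'I_n -> 'I_n -> D;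
  gw_lam' : 'I_n -> 'I_n -> D;
  gw_mu : 'I_n -> 'I_n -> D;
  gw_mu' : 'I_n -> 'I_n -> D }.

Definition gwa_data_init (D : pzRingType) (n : nat) (G : gwa_data D n.+1) :
    gwa_data D n :=
  let w := lift ord_max in
  GwaData (fun i => gw_sigma G (w i)) (fun i => gw_tau G (w i))
    (fun i => gw_a G (w i))
    (fun i j => gw_lam G (w i) (w j)) (fun i j => gw_lam' G (w i) (w j))
    (fun i j => gw_mu G (w i) (w j)) (fun i j => gw_mu' G (w i) (w j)).

Definition gwa_rel (D : pzRingType) (n : nat) (G : gwa_data D n)
    (C : pzRingType) (f : {rmorphism D -> C}) (x y : 'I_n -> C) : Prop :=
  (forall i, [/\ forall d, x i * f d = f (gw_sigma G i d) * x i,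
                 forall d, y i * f d = f (gw_tau G i d) * y i,
                 y i * x i = f (gw_a G i)
               & x i * y i = f (gw_sigma G i (gw_a G i))]) /\
  (forall i j : 'I_n, (j < i)%N ->
    [/\ x i * x j = f (gw_lam G i j) * x j * x i,
        x i * y j = f (gw_lam' G i j) * y j * x i,
        y i * x j = f (gw_mu G i j) * x j * y i
      & y i * y j = f (gw_mu' G i j) * y j * y i]).

(* A is the ring generated by D and the x_i, y_i subject to gwa_rel. *)
Definition gwa_presentation (D : pzRingType) (n : nat) (G : gwa_data D n)
    (A : pzRingType) (k : {rmorphism D -> A}) (x y : 'I_n -> A) : Prop :=
  gwa_rel G k x y /\
  forall (C : pzRingType) (f : {rmorphism D -> C}) (x' y' : 'I_n -> C),
    gwa_rel G f x' y' ->
    exists g : {rmorphism A -> C},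
      [/\ forall d, g (k d) = f d, forall i, g (x i) = x' i,
          forall i, g (y i) = y' i
        & forall h : {rmorphism A -> C}, (forall d, h (k d) = f d) ->
            (forall i, h (x i) = x' i) -> (forall i, h (y i) = y' i) ->
            h =1 g].

(* A, with the structure map k from D and the generators x, y, is a GWA of
   rank n over D with the data G: B is the ring A_{n-1} of the iterated
   construction, with structure map l and generators u, v, and S, T are the
   endomorphisms sigma_n, tau_n of B. *)
Fixpoint is_gwa (D : pzRingType) (n : nat) : gwa_data D n ->
    forall A : pzRingType,
      {rmorphism D -> A} -> ('I_n -> A) -> ('I_n -> A) -> Prop :=
  match n with
  | 0 => fun _ A k _ _ => bijective k
  | m.+1 => fun G A k x y =>
      exists (B : pzRingType) (l : {rmorphism D -> B}) (u v : 'I_m -> B)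
             (S T : {rmorphism B -> B}) (i : {rmorphism B -> A}),
      let w := lift ord_max in
      let z := ord_max in
      [/\ is_gwa (gwa_data_init G) l u v,
          is_gwa1 S T (l (gw_a G z)) i (x z) (y z),
          [/\ forall d, i (l d) = k d,
              forall j, i (u j) = x (w j)
            & forall j, i (v j) = y (w j)],
          (forall d, S (l d) = l (gw_sigma G z d)) /\
          (forall d, T (l d) = l (gw_tau G z d))
        & forall j, [/\ S (u j) = l (gw_lam G z (w j)) * u j,
                        S (v j) = l (gw_lam' G z (w j)) * v j,
                        T (u j) = l (gw_mu G z (w j)) * u j
                      & T (v j) = l (gw_mu' G z (w j)) * v j]]
  end.

(* Main.v *)
Require Import Defs.
From HB Require Import structures.
From mathcomp Require Import all_boot all_order all_algebra.
From mathcomp Require Import boolp.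

Set Implicit Arguments.
Unset Strict Implicit.
Unset Printing Implicit Defensive.

Import GRing.Theory.
Local Open Scope ring_scope.
Local Open Scope quotient_scope.

(** The commuting automorphisms make the localization [L] of [D] a module over the
would-be algebra: in the skew Laurent extension of [L] by commuting variables
[X_i] acting through [theta_i], put [x_i = X_i beta_i] and
[y_i = alpha_i X_i^-1].  Each letter then acts on [L] by an additive bijection
[v |-> c w(v)], with [c] invertible in [L] and [w] a power [theta_i^(+-1)]; since
the [w]'s commute, two letters commute up to the scalar
[c w(c') w'(c)^-1 c'^-1], and the four families of coefficients in the statement
are this one formula for the four pairs of signs ([weyl_op_swap]).

Hence every identity between coefficients that the theory demands can be read off
by applying a word in the letters to [L] in two ways: the letters act
surjectively, and [D] acts faithfully since it embeds in [L], so equal actions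
force equal coefficients.  In particular one gets that the rules
[x_j |-> lambda_ij x_j], [y_j |-> lambda'_ij y_j] and [x_j |-> mu_ij x_j],
[y_j |-> mu'_ij y_j] are compatible with all the relations among the letters of
index below [i] ([letter_rel_conj]); the only such identity with three letters is
the Yang-Baxter type one, [gcom_gcom].

The algebra is built by induction on the rank.  If [B] is presented by the
letters below the last one, the compatibility just mentioned and the universal
property of [B] extend [sigma_n] and [tau_n] to endomorphisms of [B].  The three
conditions on [a_n] required of a rank one extension of [B] hold on the generators
of [B], hence everywhere.  The ring generated over [B] by two more elements
subject to the rank one relations is then a GWA over [B], and composing the two
universal properties shows that it has the presentation over [D]
([gwa_rank_step]).  No normal form for the elements is involved: a ring presented
by generators and equations always exists ([presented]), and the definitions of a
GWA only speak of universal properties. *)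

(** * Rings presented by generators and equations *)

(** Opposites need no closure condition: [-1] belongs to the image of [k]. *)
Definition generated_over (R A : pzRingType) (I : Type) (k : R -> A)
    (z : I -> A) : Prop :=
  forall P : A -> Prop,
    (forall r, P (k r)) -> (forall i, P (z i)) ->
    (forall a b, P a -> P b -> P (a + b)) ->
    (forall a b, P a -> P b -> P (a * b)) -> forall a, P a.

Section Terms.
Variables (R : pzRingType) (I : Type).

(** Opposites are left out, being multiples by the constant [-1]. *)
Inductive term :=
  | Const of R
  | Gen of I
  | Add of term & term
  | Mul of term & term.

HB.instance Definition _ := gen_eqMixin term.
HB.instance Definition _ := gen_choiceMixin term.

Fixpoint eval (C : pzRingType) (f : R -> C) (z : I -> C) (t : term) : C :=
  match t with
  | Const r => f r
  | Gen i => z i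
  | Add t1 t2 => eval f z t1 + eval f z t2
  | Mul t1 t2 => eval f z t1 * eval f z t2
  end.

End Terms.
Arguments Const {R I}.
Arguments Gen {R I}.

Section PresentedRing.
Variables (R : pzRingType) (I : Type) (E : term R I -> term R I -> Prop).
Local Notation term := (term R I).
Implicit Types (t u : term).

Definition satisfies (C : pzRingType) (f : R -> C) (z : I -> C) : Prop :=
  forall t u, E t u -> eval f z t = eval f z u.

(** Quantifying over all rings in which the equations hold, instead of
    generating a congruence, makes every ring axiom of the quotient an instance
    of the same axiom in an arbitrary ring. *)
Definition valid t u : Prop :=
  forall (C : pzRingType) (f : {rmorphism R -> C}) (z : I -> C),
    satisfies f z -> eval f z t = eval f z u.
Definition validb t u : bool := `[< valid t u >].

Fact validb_refl : reflexive validb.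
Proof. by move=> t; apply/asboolP. Qed.

Fact validb_sym : symmetric validb.
Proof. by move=> t u; apply/asboolP/asboolP => h C f z /h ->. Qed.

Fact validb_trans : transitive validb.
Proof.
move=> u t v /asboolP h1 /asboolP h2; apply/asboolP => C f z hz.
by rewrite h1 // h2.
Qed.

Canonical validb_equiv := EquivRel validb validb_refl validb_sym validb_trans.

Definition presented := {eq_quot validb}.
HB.instance Definition _ : EqQuotient _ validb presented :=
  EqQuotient.on presented.
HB.instance Definition _ := Choice.on presented.

Local Notation cl := (\pi_presented).

Lemma presented_eqP t u : cl t = cl u <-> valid t u.
Proof. by split=> [/eqmodP/asboolP|h] //; apply/eqmodP/asboolP. Qed.

Lemma clP (a : presented) : exists t, a = cl t.
Proof. by exists (repr a); rewrite reprK. Qed.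

Lemma eval_repr (C : pzRingType) (f : {rmorphism R -> C}) (z : I -> C) t :
  satisfies f z -> eval f z (repr (cl t)) = eval f z t.
Proof. by move: C f z; apply/presented_eqP; rewrite reprK. Qed.

Definition padd (a b : presented) := cl (Add (repr a) (repr b)).
Definition pmul (a b : presented) := cl (Mul (repr a) (repr b)).
Definition popp (a : presented) := cl (Mul (Const (-1)) (repr a)).

Lemma paddE t u : padd (cl t) (cl u) = cl (Add t u).
Proof. by apply/presented_eqP=> C f z hz /=; rewrite !eval_repr. Qed.

Lemma pmulE t u : pmul (cl t) (cl u) = cl (Mul t u).
Proof. by apply/presented_eqP=> C f z hz /=; rewrite !eval_repr. Qed.

Lemma poppE t : popp (cl t) = cl (Mul (Const (-1)) t).
Proof. by apply/presented_eqP=> C f z hz /=; rewrite !eval_repr. Qed.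

Fact paddA : associative padd.
Proof.
move=> a b c; have [t ->] := clP a; have [u ->] := clP b; have [v ->] := clP c.
rewrite !paddE.
by apply/presented_eqP=> C f z hz /=; rewrite addrA.
Qed.

Fact paddC : commutative padd.
Proof.
move=> a b; have [t ->] := clP a; have [u ->] := clP b; rewrite !paddE.
by apply/presented_eqP=> C f z hz /=; rewrite addrC.
Qed.

Fact padd0 : left_id (cl (Const 0)) padd.
Proof.
move=> a; have [t ->] := clP a; rewrite !paddE.
by apply/presented_eqP=> C f z hz /=; rewrite rmorph0 add0r.
Qed.

Fact paddN : left_inverse (cl (Const 0)) popp padd.
Proof.
move=> a; have [t ->] := clP a; rewrite poppE paddE.
by apply/presented_eqP=> C f z hz /=; rewrite rmorphN1 mulN1r addNr rmorph0.
Qed.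

HB.instance Definition _ :=
  GRing.isZmodule.Build presented paddA paddC padd0 paddN.

Fact pmulA : associative pmul.
Proof.
move=> a b c; have [t ->] := clP a; have [u ->] := clP b; have [v ->] := clP c.
rewrite !pmulE.
by apply/presented_eqP=> C f z hz /=; rewrite mulrA.
Qed.

Fact pmul1 : left_id (cl (Const 1)) pmul.
Proof.
move=> a; have [t ->] := clP a; rewrite !pmulE.
by apply/presented_eqP=> C f z hz /=; rewrite rmorph1 mul1r.
Qed.

Fact pmulr1 : right_id (cl (Const 1)) pmul.
Proof.
move=> a; have [t ->] := clP a; rewrite !pmulE.
by apply/presented_eqP=> C f z hz /=; rewrite rmorph1 mulr1.
Qed.

Fact pmulDl : left_distributive pmul padd.
Proof.
move=> a b c; have [t ->] := clP a; have [u ->] := clP b; have [v ->] := clP c.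
rewrite !(pmulE, paddE).
by apply/presented_eqP=> C f z hz /=; rewrite mulrDl.
Qed.

Fact pmulDr : right_distributive pmul padd.
Proof.
move=> a b c; have [t ->] := clP a; have [u ->] := clP b; have [v ->] := clP c.
rewrite !(pmulE, paddE).
by apply/presented_eqP=> C f z hz /=; rewrite mulrDr.
Qed.

HB.instance Definition _ := GRing.Zmodule_isPzRing.Build presented
  pmulA pmul1 pmulr1 pmulDl pmulDr.

Definition pconst (r : R) : presented := cl (Const r).
Definition pgen (i : I) : presented := cl (Gen i).

Fact pconst_zmod : zmod_morphism pconst.
Proof.
move=> r s; rewrite -[RHS]/(padd _ (popp _)) poppE paddE.
by apply/presented_eqP=> C f z hz /=; rewrite rmorphN1 mulN1r rmorphB.
Qed.

Fact pconst_monoid : monoid_morphism pconst.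
Proof.
split=> // r s; rewrite -[RHS]/(pmul _ _) pmulE.
by apply/presented_eqP=> C f z hz /=; rewrite rmorphM.
Qed.

HB.instance Definition _ :=
  GRing.isZmodMorphism.Build R presented pconst pconst_zmod.
HB.instance Definition _ :=
  GRing.isMonoidMorphism.Build R presented pconst pconst_monoid.

Lemma eval_presented t : eval pconst pgen t = cl t.
Proof.
elim: t => //= t -> u ->; first exact: paddE.
exact: pmulE.
Qed.

Lemma presented_satisfies : satisfies pconst pgen.
Proof.
move=> t u htu; rewrite !eval_presented; apply/presented_eqP => C f z hz.
exact: hz.
Qed.

Lemma presented_generated : generated_over pconst pgen.
Proof.
move=> P hk hz hD hM; move=> a; have [t ->] := clP a; rewrite -eval_presented.
by elim: t => //= t ht u hu; [exact: hD | exact: hM].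
Qed.

Section Lift.
Variables (C : pzRingType) (f : {rmorphism R -> C}) (z : I -> C).
Hypothesis hz : satisfies f z.

Definition plift (a : presented) : C := eval f z (repr a).

Lemma pliftE t : plift (cl t) = eval f z t.
Proof. exact: eval_repr. Qed.

Fact plift_zmod : zmod_morphism plift.
Proof.
move=> a b; have [t ->] := clP a; have [u ->] := clP b.
rewrite -[cl t - cl u]/(padd _ (popp _)).
by rewrite poppE paddE !pliftE /= rmorphN1 mulN1r.
Qed.

Fact plift_monoid : monoid_morphism plift.
Proof.
split; first by rewrite -[1]/(cl (Const 1)) pliftE /= rmorph1.
move=> a b; have [t ->] := clP a; have [u ->] := clP b.
rewrite -[cl t * cl u]/(pmul _ _).
by rewrite pmulE !pliftE.
Qed.

HB.instance Definition _ :=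
  GRing.isZmodMorphism.Build presented C plift plift_zmod.
HB.instance Definition _ :=
  GRing.isMonoidMorphism.Build presented C plift plift_monoid.

Lemma presented_lift : exists g : {rmorphism presented -> C},
  (forall r, g (pconst r) = f r) /\ (forall i, g (pgen i) = z i).
Proof. by exists plift; split=> j; exact: pliftE. Qed.

End Lift.
End PresentedRing.

Lemma generated_eq (R A C : pzRingType) (I : Type) (k : R -> A) (z : I -> A)
    (g h : {rmorphism A -> C}) : generated_over k z ->
  (forall r, g (k r) = h (k r)) -> (forall i, g (z i) = h (z i)) -> g =1 h.
Proof.
move=> gen hk hz; apply: gen => // a b ha hb; first by rewrite !rmorphD ha hb.
by rewrite !rmorphM ha hb.
Qed.

(** The elements [a] with [c g(a) = h(a) c] form a subring, so that such a
commutation rule needs to be checked on generators only. *)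
Lemma generated_twist (R A C : pzRingType) (I : Type) (k : R -> A) (z : I -> A)
    (g h : {rmorphism A -> C}) (c : C) : generated_over k z ->
  (forall r, c * g (k r) = h (k r) * c) ->
  (forall i, c * g (z i) = h (z i) * c) ->
  forall a, c * g a = h a * c.
Proof.
move=> gen hk hz; apply: gen => // a b ha hb.
  by rewrite !rmorphD mulrDr mulrDl ha hb.
by rewrite !rmorphM mulrA ha -mulrA hb mulrA.
Qed.

(** * Generalized Weyl algebras of rank one *)

Section RankOne.
Variables (R : pzRingType) (s t : {rmorphism R -> R}) (a : R).

(** The generators [true] and [false] are [x] and [y]. *)
Inductive gwa1_eqn : term R bool -> term R bool -> Prop :=
  | Gwa1Comm e r :
      gwa1_eqn (Mul (Gen e) (Const r))
        (Mul (Const ((if e then s else t) r)) (Gen e))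
  | Gwa1Prod e :
      gwa1_eqn (Mul (Gen e) (Gen (~~ e))) (Const (if e then s a else a)).

Lemma gwa1_relP (C : pzRingType) (f : {rmorphism R -> C}) (z : bool -> C) :
  gwa1_rel s t a f (z true) (z false) <-> satisfies gwa1_eqn f z.
Proof.
split=> [[hx hy hyx hxy] _ _ [] | h]; first by move=> [] r /=.
  by case=> /=.
split=> [r|r||].
- exact: (h _ _ (Gwa1Comm true r)).
- exact: (h _ _ (Gwa1Comm false r)).
- exact: (h _ _ (Gwa1Prod false)).
- exact: (h _ _ (Gwa1Prod true)).
Qed.

Theorem gwa1_exists :
    t (s a) = a -> (forall r, a * r = t (s r) * a) ->
    (forall r, s a * r = s (t r) * s a) ->
  exists (A : pzRingType) (i : {rmorphism R -> A}) (z : bool -> A),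
    is_gwa1 s t a i (z true) (z false) /\ generated_over i z.
Proof.
move=> h1 h2 h3; pose A : pzRingType := presented gwa1_eqn.
pose i : {rmorphism R -> A} := @pconst R bool gwa1_eqn.
have gen := @presented_generated _ _ gwa1_eqn.
exists A, i, (@pgen _ _ gwa1_eqn); split=> //; split=> //.
  exact/gwa1_relP/presented_satisfies.
move=> C f x' y' hC; pose z' (e : bool) := if e then x' else y'.
have hz : satisfies gwa1_eqn f z' by apply/gwa1_relP.
have [g [gk gz]] := presented_lift hz.
exists g; split=> [//|||h hk hx hy]; first exact: (gz true).
  exact: (gz false).
apply: (generated_eq gen) => [r|e]; first by rewrite hk gk.
by rewrite gz; case: e.
Qed.

End RankOne.

(** * The data of a GWA, indexed by letters *)

(** [(true, i)] stands for [x_i] and [(false, i)] for [y_i].  This way the four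
kinds of relations between letters become one, and every verification below is
made once instead of for each choice of signs. *)
Definition letter (n : nat) : Type := (bool * 'I_n)%type.
Definition flip (n : nat) (p : letter n) : letter n := (~~ p.1, p.2).

Section Letters.
Variables (D : pzRingType) (n : nat) (G : gwa_data D n).
Implicit Types (p q s : letter n) (d : D).

Definition gaut p : D -> D := if p.1 then gw_sigma G p.2 else gw_tau G p.2.
(** The value of the product of the letters [p] and [flip p], in this order. *)
Definition gprod p : D :=
  if p.1 then gw_sigma G p.2 (gw_a G p.2) else gw_a G p.2.
Definition gcom p q : D :=
  (if p.1 then if q.1 then gw_lam G else gw_lam' G
   else if q.1 then gw_mu G else gw_mu' G) p.2 q.2.

Definition letter_rel (C : pzRingType) (f : {rmorphism D -> C})
    (z : letter n -> C) : Prop :=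
  [/\ forall p d, z p * f d = f (gaut p d) * z p,
      forall p, z p * z (flip p) = f (gprod p)
    & forall p q, (q.2 < p.2)%N -> z p * z q = f (gcom p q) * z q * z p].

Lemma gwa_relP (C : pzRingType) (f : {rmorphism D -> C}) (z : letter n -> C) :
  gwa_rel G f (fun i => z (true, i)) (fun i => z (false, i)) <-> letter_rel f z.
Proof.
split=> [[h1 h2] | [h1 h2 h3]].
  split=> [[e i] d | [e i] | [e i] [e' j] /= hji].
  - by have [hx hy _ _] := h1 i; case: e.
  - by have [_ _ hyx hxy] := h1 i; case: e.
  - by have [] := h2 i j hji; case: e; case: e'.
split=> [i | i j hji].
  split=> [d|d||]; [exact: h1|exact: h1|exact: (h2 (false, i))|].
  exact: (h2 (true, i)).
by split; rewrite h3.
Qed.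

(** Faithfulness of [D] and surjectivity of the letters are what allows coefficients
to be compared: see [act_cancel]. *)
Record letter_action (V : Type) (act : D -> V -> V) (Z : letter n -> V -> V) :
    Prop := LetterAction {
  actM : forall d e v, act (d * e) v = act d (act e v);
  act_faithful : forall d e, act d =1 act e -> d = e;
  Z_onto : forall p v, exists u, Z p u = v;
  Z_act : forall p d v, Z p (act d v) = act (gaut p d) (Z p v);
  Z_flip : forall p v, Z p (Z (flip p) v) = act (gprod p) v;
  Z_swap : forall p q, (q.2 < p.2)%N ->
    forall v, Z p (Z q v) = act (gcom p q) (Z q (Z p v)) }.

Section Identities.
Variables (V : Type) (act : D -> V -> V) (Z : letter n -> V -> V).
Hypothesis hZ : letter_action act Z.

Lemma act_cancel p d e : (forall v, act d (Z p v) = act e (Z p v)) -> d = e.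
Proof.
by move=> h; apply: (act_faithful hZ) => v; have [u <-] := Z_onto hZ p v.
Qed.

Lemma flipK p : flip (flip p) = p.
Proof. by case: p => e i; rewrite /flip /= negbK. Qed.

(** Each of the identities below compares two ways of rewriting one word in letters
and elements of [D].  Here the word is [s p d]; the next ones are [s p (flip p)],
[s p q], [s (flip s) p], [s (flip s) d] and [s (flip s) s]. *)
Lemma gcom_gaut s p d : (p.2 < s.2)%N ->
  gcom s p * gaut p (gaut s d) = gaut s (gaut p d) * gcom s p.
Proof.
move=> hps; apply: (@act_cancel p) => v; have [{v}v <-] := Z_onto hZ s v.
by rewrite !(actM hZ) -!(Z_act hZ) -!(Z_swap hZ) // -!(Z_act hZ).
Qed.

Lemma gaut_gprod s p : (p.2 < s.2)%N ->
  gcom s p * gaut p (gcom s (flip p)) * gprod p = gaut s (gprod p).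
Proof.
move=> hps; apply: (@act_cancel s) => v.
rewrite -(Z_act hZ) -(Z_flip hZ) !(actM hZ) -(Z_flip hZ) -(Z_act hZ).
by rewrite -!(Z_swap hZ).
Qed.

Lemma gcom_gcom s p q : (p.2 < s.2)%N -> (q.2 < p.2)%N ->
  gcom s p * gaut p (gcom s q) * gcom p q =
  gaut s (gcom p q) * gcom s q * gaut q (gcom s p).
Proof.
move=> hps hqp; have hqs := ltn_trans hqp hps.
apply: (@act_cancel q) => v; have [{v}v <-] := Z_onto hZ p v.
have [{v}v <-] := Z_onto hZ s v.
rewrite !(actM hZ) -(Z_swap hZ hqp) -(Z_act hZ) -(Z_swap hZ hqs).
rewrite -(Z_swap hZ hps) -(Z_act hZ) -(Z_swap hZ hps) -(Z_swap hZ hqs).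
by rewrite -(Z_act hZ) -(Z_swap hZ hqp).
Qed.

Lemma gprod_gcom s p : (p.2 < s.2)%N ->
  gprod s = gaut s (gcom (flip s) p) * gcom s p * gaut p (gprod s).
Proof.
move=> hps; apply: (@act_cancel p) => v.
rewrite !(actM hZ) -(Z_act hZ) -!(Z_flip hZ) -(Z_swap hZ hps).
by rewrite -(Z_act hZ) -(Z_swap hZ).
Qed.

Lemma gprod_gaut s d : gprod s * d = gaut s (gaut (flip s) d) * gprod s.
Proof.
apply: (act_faithful hZ) => v.
by rewrite !(actM hZ) -!(Z_flip hZ) -!(Z_act hZ).
Qed.

Lemma gaut_flip_gprod s : gaut s (gprod (flip s)) = gprod s.
Proof.
apply: (@act_cancel s) => v; rewrite -(Z_act hZ) -!(Z_flip hZ).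
by rewrite flipK.
Qed.

End Identities.
End Letters.

(** * Splitting off the last two letters *)

Section LastLetter.
Variable m : nat.

Definition up_letter (p : letter m) : letter m.+1 := (p.1, lift ord_max p.2).
Definition top_letter (e : bool) : letter m.+1 := (e, ord_max).

Definition extend (A : Type) (z : letter m -> A) (w : bool -> A)
    (p : letter m.+1) : A :=
  if unlift ord_max p.2 is Some j then z (p.1, j) else w p.1.

Lemma extend_up A (z : letter m -> A) w p : extend z w (up_letter p) = z p.
Proof. by case: p => e j; rewrite /extend /= liftK. Qed.

Lemma extend_top A (z : letter m -> A) w e : extend z w (top_letter e) = w e.
Proof. by rewrite /extend /= unlift_none. Qed.

Variant letter_spec : letter m.+1 -> Type :=
  | LetterUp p : letter_spec (up_letter p)
  | LetterTop e : letter_spec (top_letter e).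

Lemma letterP p : letter_spec p.
Proof.
case: p => e i; case: (unliftP ord_max i) => [j|] ->; last exact: LetterTop.
exact: (LetterUp (e, j)).
Qed.

Lemma up_lt p q : ((up_letter q).2 < (up_letter p).2)%N = (q.2 < p.2)%N.
Proof. by rewrite -[LHS]/(lift ord_max q.2 < lift ord_max p.2)%N !lift_max. Qed.

Lemma up_top p e : ((up_letter p).2 < (top_letter e).2)%N.
Proof.
rewrite -[X in (X < _)%N]/(nat_of_ord (lift ord_max p.2)) lift_max.
exact: ltn_ord.
Qed.

End LastLetter.

Section InitialData.
Variables (D : pzRingType) (m : nat) (G : gwa_data D m.+1).
Local Notation G0 := (gwa_data_init G).

Lemma gaut_init p : gaut G0 p = gaut G (up_letter p).
Proof. by []. Qed.
Lemma gprod_init p : gprod G0 p = gprod G (up_letter p).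
Proof. by []. Qed.
Lemma gcom_init p q : gcom G0 p q = gcom G (up_letter p) (up_letter q).
Proof. by case: p q => [[] i] [[] j]. Qed.
Definition init_E := (gaut_init, gprod_init, gcom_init).

Lemma letter_action_init (V : Type) (act : D -> V -> V) Z :
  letter_action G act Z -> letter_action G0 act (fun p => Z (up_letter p)).
Proof.
case=> h1 h2 h3 h4 h5 h6.
by split=> // p q hqp v; rewrite init_E -h6 // up_lt.
Qed.

Variables (V : Type) (act : D -> V -> V) (Z : letter m.+1 -> V -> V).
Hypothesis hZ : letter_action G act Z.
Variables (B : pzRingType) (l : {rmorphism D -> B}) (z : letter m -> B).
Hypothesis hz : letter_rel G0 l z.

(** Conjugation by the last letter [top_letter e], defined on the generators of the
lower rank algebra, respects the relations of that algebra. *)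
Lemma letter_rel_conj (e : bool) (s : {rmorphism D -> D}) :
    s =1 gaut G (top_letter m e) ->
  letter_rel G0 (l \o s : {rmorphism D -> B})
    (fun p => l (gcom G (top_letter m e) (up_letter p)) * z p).
Proof.
move=> hs; have [h1 h2 h3] := hz; have ht p := up_top p e.
split=> [p d | p | p q hqp] /=; rewrite !hs ?init_E.
- rewrite -mulrA h1 init_E !mulrA -!rmorphM; congr (l _ * _).
  exact: (gcom_gaut hZ).
- rewrite mulrA -[X in X * _]mulrA h1 -!mulrA h2 !init_E -!rmorphM.
  by rewrite mulrA (gaut_gprod hZ).
rewrite mulrA -[X in X * _]mulrA h1 -!mulrA h3 // ![l _ * (_ * _)]mulrA.
rewrite [z q * _]mulrA h1 !init_E !mulrA -!rmorphM.
by rewrite (gcom_gcom hZ) // up_lt.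
Qed.

End InitialData.

(** * The induction on the rank *)

Section Presentation.
Variables (D : pzRingType) (n : nat) (G : gwa_data D n).
Variables (A : pzRingType) (k : {rmorphism D -> A}) (z : letter n -> A).

(** Generation over [D] follows from the presentation; it is carried along because
identities in [A] are proved by induction on generated elements. *)
Definition letter_gwa : Prop :=
  [/\ gwa_presentation G k (fun i => z (true, i)) (fun i => z (false, i)),
      is_gwa G k (fun i => z (true, i)) (fun i => z (false, i))
    & generated_over k z].

Lemma presentation_lift (C : pzRingType) (f : {rmorphism D -> C})
    (z' : letter n -> C) :
    gwa_presentation G k (fun i => z (true, i)) (fun i => z (false, i)) ->
    letter_rel G f z' ->
  exists g : {rmorphism A -> C},
    (forall d, g (k d) = f d) /\ (forall p, g (z p) = z' p).
Proof.
case=> _ univ /gwa_relP/univ[g [gk gx gy _]].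
by exists g; split=> // -[[] i].
Qed.

Lemma presentation_intro :
    letter_rel G k z -> generated_over k z ->
    (forall (C : pzRingType) (f : {rmorphism D -> C}) (z' : letter n -> C),
      letter_rel G f z' ->
      exists g : {rmorphism A -> C},
        (forall d, g (k d) = f d) /\ (forall p, g (z p) = z' p)) ->
  gwa_presentation G k (fun i => z (true, i)) (fun i => z (false, i)).
Proof.
move=> hz gen lift; split=> [|C f x' y' hC]; first exact/gwa_relP.
pose z' (p : letter n) := if p.1 then x' p.2 else y' p.2.
have [|g [gk gz]] := lift C f z'; first by apply/gwa_relP.
exists g; split=> [//|i|i|h hk hx hy]; [exact: gz|exact: gz|].
apply: (generated_eq gen) => [d|[[] i]]; first by rewrite hk gk.
  by rewrite hx gz.
by rewrite hy gz.
Qed.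

End Presentation.

Section RankStep.
Variables (D : pzRingType) (m : nat) (G : gwa_data D m.+1).
Local Notation G0 := (gwa_data_init G).

Lemma letter_rel_last (C : pzRingType) (f : {rmorphism D -> C})
    (z : letter m.+1 -> C) :
  letter_rel G f z <->
  [/\ letter_rel G0 f (fun p => z (up_letter p)),
      forall e d, z (top_letter m e) * f d =
        f (gaut G (top_letter m e) d) * z (top_letter m e),
      forall e, z (top_letter m e) * z (top_letter m (~~ e)) =
        f (gprod G (top_letter m e))
    & forall e p, z (top_letter m e) * z (up_letter p) =
        f (gcom G (top_letter m e) (up_letter p)) * z (up_letter p) *
        z (top_letter m e)].
Proof.
split=> [[h1 h2 h3] | [[h1 h2 h3] h4 h5 h6]].
  split=> [|e d|e|e p]; [|exact: h1|exact: h2|by rewrite h3 // up_top].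
  split=> [p d|p|p q hqp]; rewrite init_E ?h1 -?h2 //.
  by rewrite h3 // up_lt.
split=> [p d|p|p q].
- by case: (letterP p) d => [{}p|e] d; rewrite ?h4 // h1.
- by case: (letterP p) => [{}p|e]; [rewrite -gprod_init -h2 | rewrite -h5].
case: (letterP p) => {p}[p|e]; case: (letterP q) => {q}[q|e'].
- by rewrite up_lt => /h3 ->; rewrite init_E.
- by rewrite ltnNge ltnW ?up_top.
- by rewrite h6.
- by rewrite ltnn.
Qed.

Variable s : bool -> {rmorphism D -> D}.
Hypothesis hs : forall e, s e =1 gaut G (top_letter m e).
Variables (V : Type) (act : D -> V -> V) (Z : letter m.+1 -> V -> V).
Hypothesis hZ : letter_action G act Z.
Variables (B : pzRingType) (l : {rmorphism D -> B}) (z : letter m -> B).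
Hypothesis hB : letter_gwa G0 l z.

Lemma conj_endo e : exists S : {rmorphism B -> B},
  (forall d, S (l d) = l (gaut G (top_letter m e) d)) /\
  (forall p, S (z p) = l (gcom G (top_letter m e) (up_letter p)) * z p).
Proof.
have [presB _ _] := hB.
have hz : letter_rel G0 l z by apply/gwa_relP; case: presB.
have [S [Sl Sz]] := presentation_lift presB (letter_rel_conj hZ hz (hs e)).
by exists S; split=> [d|//]; rewrite Sl /= hs.
Qed.

Lemma gwa_rank_step : exists (A : pzRingType) (k : {rmorphism D -> A})
  (z' : letter m.+1 -> A), letter_gwa G k z'.
Proof.
have [S [Sl Sz]] := conj_endo true; have [T [Tl Tz]] := conj_endo false.
pose U (e : bool) := if e then S else T.
have Ul e d : U e (l d) = l (gaut G (top_letter m e) d) by case: e.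
have Uz e p : U e (z p) = l (gcom G (top_letter m e) (up_letter p)) * z p.
  by case: e.
have [presB isB genB] := hB.
have hz : letter_rel G0 l z by apply/gwa_relP; case: presB.
have hcomm e b : l (gprod G (top_letter m e)) * b =
    (U e \o U (~~ e) : {rmorphism B -> B}) b * l (gprod G (top_letter m e)).
  apply: (generated_twist (g := idfun) genB) => [d|p] /=.
    by rewrite !Ul -!rmorphM (gprod_gaut hZ).
  have [zl _ _] := hz.
  rewrite Uz rmorphM Ul Uz -!mulrA zl init_E !mulrA -!rmorphM.
  by rewrite [gprod G _ in LHS](gprod_gcom hZ (up_top p e)).
have [A [i [w [gwaA genA]]]] : exists (A : pzRingType) (i : {rmorphism B -> A})
    (w : bool -> A),
    is_gwa1 S T (l (gw_a G ord_max)) i (w true) (w false) /\ generated_over i w.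
  apply: gwa1_exists => [|b|b].
  - rewrite Sl Tl; congr (l _).
    exact: (gaut_flip_gprod hZ (top_letter m false)).
  - exact: (hcomm false).
  - by rewrite Sl; exact: (hcomm true).
pose k : {rmorphism D -> A} := i \o l.
pose z' := extend (fun p => i (z p)) w.
have z'up p : z' (up_letter p) = i (z p) by exact: extend_up.
have z'top e : z' (top_letter m e) = w e by exact: extend_top.
have [_ /gwa1_relP relA univA] := gwaA.
have genz' : generated_over k z'.
  move=> P hk hz' hD hM; apply: genA => //; last by move=> e; rewrite -z'top.
  apply: genB => // [p|a b ha hb|a b ha hb].
  - by rewrite -z'up.
  - by rewrite rmorphD; exact: hD.
  - by rewrite rmorphM; exact: hM.
have relz' : letter_rel G k z'.
  have wi e b : w e * i b = i (U e b) * w e.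
    by rewrite [LHS](relA _ _ (Gwa1Comm _ _ _ e b)) /=; case: e.
  apply/letter_rel_last; split=> [|e d|e|e p].
  - have [h1 h2 h3] := hz.
    by split=> [p d|p|p q hqp]; rewrite ?z'up -!rmorphM ?h1 ?h2 ?h3 // !rmorphM.
  - by rewrite z'top wi Ul.
  - rewrite !z'top [LHS](relA _ _ (Gwa1Prod _ _ _ e)) /=.
    by case: e => //; rewrite Sl.
  - by rewrite z'top z'up wi Uz rmorphM.
exists A, k, z'; split=> //.
  apply: presentation_intro => // C f z'' relC.
  have [relC0 h1 h2 h3] := (letter_rel_last _ _).1 relC.
  have [g0 [g0l g0z]] := presentation_lift presB relC0.
  (* The images of the last letters commute with [g0 b] as the rank one relations
     require: this is known for [b] a generator of [B]. *)
  have tw e : forall b, z'' (top_letter m e) * g0 b =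
      (g0 \o U e : {rmorphism B -> C}) b * z'' (top_letter m e).
    apply: (generated_twist genB) => [d|p] /=.
      by rewrite Ul !g0l h1.
    by rewrite Uz rmorphM g0l !g0z h3.
  have [|g [gi gx gy _]] :=
    univA C g0 (z'' (top_letter m true)) (z'' (top_letter m false)).
    split; [exact: (tw true)|exact: (tw false)| |].
      by rewrite (h2 false) g0l.
    by rewrite (h2 true) Sl g0l.
  exists g; split=> [d|p]; first by rewrite /= gi g0l.
  case: (letterP p) => {p}[p|e]; first by rewrite z'up gi g0z.
  by rewrite z'top; case: e.
exists B, l, (fun j => z (true, j)), (fun j => z (false, j)), S, T, i.
split=> //.
  by rewrite (z'top true) (z'top false).
by split=> // j; exact/esym/(z'up (_, j)).
Qed.

End RankStep.

(** Any faithful surjective action witnesses that the data are consistent.  The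
maps [sigma_i] and [tau_i] of the data are bare functions, whence the morphisms
[s]. *)
Theorem gwa_exists (D : pzRingType) (n : nat) (G : gwa_data D n)
    (s : letter n -> {rmorphism D -> D}) (V : Type) (act : D -> V -> V)
    (Z : letter n -> V -> V) :
    (forall p, s p =1 gaut G p) -> letter_action G act Z ->
  exists (A : pzRingType) (k : {rmorphism D -> A}) (z : letter n -> A),
    letter_gwa G k z.
Proof.
elim: n G s Z => [|m IHm] G s Z hs hZ.
  exists D, idfun, (fun=> 0); split.
  - split=> [|C f x' y' _]; first by split; case.
    by exists f; split=> // -[].
  - by exists id.
  - by move=> P hk *; exact: hk.
have hZ0 := letter_action_init hZ.
have [B [l [z hB]]] :=
  IHm (gwa_data_init G) (fun p => s (up_letter p)) _
  (fun p => hs (up_letter p)) hZ0.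
exact: (gwa_rank_step (s := fun e => s (top_letter m e))
  (fun e => hs (top_letter m e)) hZ hB).
Qed.

(** * The action on the localization *)

Section WeylAction.
Variables (D : pzRingType) (n : nat) (theta : 'I_n -> raut D).
Hypothesis theta_comm : forall i j d, theta i (theta j d) = theta j (theta i d).
Variables (alpha beta : 'I_n -> nreg D).
Implicit Types (p q : letter n).

Definition waut p : raut D := if p.1 then theta p.2 else raut_inv (theta p.2).
(** [x_i = X_i beta_i = theta_i(beta_i) X_i], so that its left coefficient is
[theta_i(beta_i)]; that of [y_i = alpha_i X_i^-1] is [alpha_i]. *)
Definition wcoef p : nreg D :=
  if p.1 then raut_nreg (theta p.2) (beta p.2) else alpha p.2.
Definition weyl_op p (v : loc D) : loc D :=
  loc_in (wcoef p : D) * loc_map (waut p) v.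

Lemma waut_comm p q d : waut p (waut q d) = waut q (waut p d).
Proof.
have inv_l i j e :
    raut_inv (theta i) (theta j e) = theta j (raut_inv (theta i) e).
  by apply: (can_inj (rautK (theta i))); rewrite theta_comm !(rautVK (theta i)).
case: p q => [[] i] [[] j]; rewrite /waut /=.
- exact: theta_comm.
- exact/esym/inv_l.
- exact: inv_l.
apply: (can_inj (rautK (theta j))).
by rewrite -[LHS]inv_l !(rautVK (theta j)).
Qed.

Lemma loc_map_waut_comm p q v :
  loc_map (waut p) (loc_map (waut q) v) = loc_map (waut q) (loc_map (waut p) v).
Proof.
elim/quotW: v => -[s d]; rewrite !loc_mapE; apply/loc_eqP.
by exists (nreg1 D), (nreg1 D); rewrite /= !mul1r !(waut_comm p q).
Qed.

Lemma loc_map_can (f g : raut D) : cancel f g -> cancel (loc_map f) (loc_map g).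
Proof.
move=> fK v; elim/quotW: v => -[s d].
rewrite [loc_map f _]loc_mapE loc_mapE; apply/loc_eqP.
by exists (nreg1 D), (nreg1 D); rewrite /= !fK.
Qed.

Lemma weyl_op_onto p v : exists u, weyl_op p u = v.
Proof.
exists (loc_map (raut_inv (waut p)) (loc_inv (wcoef p) * v)).
rewrite /weyl_op (@loc_map_can (raut_inv _) _ (rautVK (waut p))).
by rewrite mulrA loc_mulrV mul1r.
Qed.

Lemma weyl_op_act p d v :
  weyl_op p (loc_in d * v) = loc_in (omega (wcoef p) (waut p d)) * weyl_op p v.
Proof. by rewrite /weyl_op rmorphM /= loc_map_in !mulrA -!rmorphM omegaP. Qed.

Lemma weyl_op_flip p v :
  weyl_op p (weyl_op (flip p) v) =
  loc_in ((wcoef p : D) * waut p (wcoef (flip p) : D)) * v.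
Proof.
rewrite /weyl_op rmorphM /= loc_map_in mulrA -rmorphM; congr (_ * _).
by case: p => [[] i]; apply: (@loc_map_can (waut (flip _)) (waut _));
  [exact: rautVK | exact: rautK].
Qed.

(** As the automorphisms commute, the operators of [p] and [q] in either order are
multiples of the same automorphism; [d] is the quotient of the two
coefficients. *)
Lemma weyl_op_swap p q d v :
    loc_in d = loc_in (wcoef p : D) * loc_map (waut p) (loc_in (wcoef q : D)) *
      loc_map (waut q) (loc_inv (wcoef p)) * loc_inv (wcoef q) ->
  weyl_op p (weyl_op q v) = loc_in d * weyl_op q (weyl_op p v).
Proof.
move=> ->; rewrite /weyl_op !rmorphM !mulrA -!mulrA; congr (_ * (_ * _)).
rewrite !mulrA -[_ * _ * loc_in _]mulrA loc_mulVr mulr1 -rmorphM loc_mulVr.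
by rewrite rmorph1 mul1r; exact: loc_map_waut_comm.
Qed.

End WeylAction.

Theorem proposition4p3 (D : pzRingType) (n : nat)
  (theta : 'I_n -> raut D)
  (theta_comm : forall i j d, theta i (theta j d) = theta j (theta i d))
  (alpha beta : 'I_n -> nreg D)
  (lam lam' mu mu' : 'I_n -> 'I_n -> D)
  (lamE : forall i j : 'I_n, (j < i)%N ->
     loc_in (lam i j) =
       loc_map (theta i) (loc_in (beta i)) *
       loc_map (theta i)
         (loc_map (theta j) (loc_in (beta j) * loc_inv (beta i))) *
       loc_map (theta j) (loc_inv (beta j)))
  (lam'E : forall i j : 'I_n, (j < i)%N ->
     loc_in (lam' i j) =
       loc_map (theta i) (loc_in (beta i) * loc_in (alpha j)) *
       loc_map (raut_inv (theta j)) (loc_map (theta i) (loc_inv (beta i))) *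
       loc_inv (alpha j))
  (muE : forall i j : 'I_n, (j < i)%N ->
     loc_in (mu i j) =
       loc_in (alpha i) *
       loc_map (raut_inv (theta i)) (loc_map (theta j) (loc_in (beta j))) *
       loc_map (theta j) (loc_inv (alpha i) * loc_inv (beta j)))
  (mu'E : forall i j : 'I_n, (j < i)%N ->
     loc_in (mu' i j) =
       loc_in (alpha i) *
       loc_map (raut_inv (theta i)) (loc_in (alpha j)) *
       loc_map (raut_inv (theta j)) (loc_inv (alpha i)) *
       loc_inv (alpha j)) :
  let G := GwaData
    (fun i d => theta i (omega (beta i) d))
    (fun i d => omega (alpha i) (raut_inv (theta i) d))
    (fun i => (alpha i : D) * (beta i : D))
    lam lam' mu mu' in
  exists (A : pzRingType) (k : {rmorphism D -> A}) (x y : 'I_n -> A),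
    gwa_presentation G k x y /\ is_gwa G k x y.
Proof.
move=> G.
have hact : letter_action G (fun d v => loc_in d * v)
    (weyl_op theta alpha beta).
  split=> [d e v|d e h|p v|p d v|p v|p q hqp v].
  - by rewrite rmorphM mulrA.
  - by apply: loc_in_inj; have := h 1; rewrite !mulr1.
  - exact: weyl_op_onto.
  - rewrite weyl_op_act; congr (loc_in _ * _); case: p => [[] i] //.
    by apply: omega_uniq; rewrite -!rmorphM omegaP.
  - rewrite weyl_op_flip; congr (loc_in _ * _); case: p => [[] i] /=.
      rewrite /gprod /= -rmorphM; congr (theta i _).
      by apply/esym/omega_uniq; rewrite mulrA.
    by rewrite /waut /= rautK.
  - apply: weyl_op_swap => //; case: p q hqp => [[] i] [[] j] /= hji.
    + rewrite [LHS]lamE // /wcoef /= -!loc_map_in -!loc_map_inv !rmorphM !mulrA.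
      congr (_ * _ * _).
      exact: (loc_map_waut_comm theta_comm (true, i) (true, j)).
    + by rewrite [LHS]lam'E // /wcoef /= -loc_map_in -loc_map_inv rmorphM.
    + by rewrite [LHS]muE // /wcoef /= -loc_map_in -loc_map_inv rmorphM mulrA.
    + exact: mu'E.
pose s (p : letter n) : {rmorphism D -> D} :=
  if p.1 then (theta p.2 \o omega (beta p.2) : {rmorphism D -> D})
  else (omega (alpha p.2) \o raut_inv (theta p.2) : {rmorphism D -> D}).
have hs p : s p =1 gaut G p by case: p => [[] i].
have [A [k [z [hpres hgwa _]]]] := gwa_exists hs hact.
by exists A, k, (fun i => z (true, i)), (fun i => z (false, i)).
Qed.
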